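(* Assume the sharpness condition: there is $\lambda_s>0$ with $F(x)-F(x_\star)\ge\lambda_s\Delta(x)$ for all $x\in\mathbb R^n$. Let $\tilde p\in(0,1)$ with $m\tilde p$ a positive integer, and let $u_L,u_H>0$ be constants such that $$r^{\tilde p}(x)\in\big[u_L(F(x)-F(x_\star)),\ u_H(F(x)-F(x_\star))\big]\quad\text{for all }x\in\mathbb R^n.$$ Let $0<G<2/u_H$, $c_1:=u_LG$, $c_2:=u_HG$ (so that $0<c_1\le c_2<2$), and $c:=\max\{|1-c_1|,|1-c_2|\}$. Let $\{x^k\}_{k\ge0}$ be generated by AdaSubGrad from $x^0$, i.e. $$x^{k+1}=x^k-\alpha_k\,\xi^k/\|\xi^k\|_2^2,\qquad \xi^k\in\partial F(x^k),\qquad \alpha_k=G\,r^{\tilde p}(x^k),\qquad k=0,1,2,\dots$$ If $\Delta(x^0)\le\lambda_s\big(1-\tfrac{c_2}{2}\big)/L$, then $$\Delta(x^k)\le\left(\sqrt{1-\frac{2\lambda_s^2(1-c^2)}{9L^2\|x_\star\|_2^2}}\right)^k\Delta(x^0)\qquad\text{for all }k\ge0.$$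
   Context: Setting (robust phase retrieval): $a_1,\dots,a_m\in\mathbb R^n$, $A=[a_1,\dots,a_m]^\top\in\mathbb R^{m\times n}$, $x_\star\in\mathbb R^n$, and $b_i\ge0$ with $b_i=\langle a_i,x_\star\rangle^2$ for $i\in\mathcal I_1$ and $b_i$ an arbitrary non-negative number for $i\in\mathcal I_2$, where $\mathcal I_1,\mathcal I_2$ partition $[m]=\{1,\dots,m\}$. Define $F(x)=\frac1m\sum_{i=1}^m|\langle a_i,x\rangle^2-b_i|$, $L=2\|A\|_2^2/m$ ($\|A\|_2$ the spectral norm), and $\Delta(x)=\min\{\|x-x_\star\|_2,\|x+x_\star\|_2\}$. Let $r_i(x)=|\langle a_i,x\rangle^2-b_i|$; $r^{\tilde p}(x)$ is the $(m\tilde p)$-th order statistic ($(m\tilde p)$-th smallest value, with multiplicity) of $r_1(x),\dots,r_m(x)$. The subdifferential is $\partial F(x)=[J_c(x)]^\top\partial h(c(x))$, where $h(z)=\frac1m\|z\|_1$, $c(x)=(\langle a_i,x\rangle^2-b_i)_{i=1}^m$ and $J_c(x)=2\,\mathrm{diag}(Ax)A$; i.e. $\partial F(x)$ consists of the vectors $\frac2m\sum_{i=1}^m\langle a_i,x\rangle s_i a_i$ with $s_i=\mathrm{sign}(\langle a_i,x\rangle^2-b_i)$ when $\langle a_i,x\rangle^2\ne b_i$ and $s_i\in[-1,1]$ otherwise. Convention: if $\xi^k=\mathbf 0$ then $x^{k+1}=x^k$. *)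

(* Defs.v *)
From mathcomp Require Import all_boot all_order all_algebra.
From mathcomp Require Import classical_sets reals.
Set Implicit Arguments.
Unset Strict Implicit.
Unset Printing Implicit Defensive.
Import Order.TTheory GRing.Theory Num.Theory.
Local Open Scope classical_set_scope.
Local Open Scope ring_scope.

(* The norm that MathComp-Analysis puts on matrices is the sup norm, so the
   Euclidean inner product and norm are defined here. *)
Definition dot (R : realType) (n : nat) (u v : 'cV[R]_n) : R :=
  \sum_(i < n) u i 0 * v i 0.

Definition norm2 (R : realType) (n : nat) (u : 'cV[R]_n) : R :=
  Num.sqrt (dot u u).

(* The unit ball, rather than the unit sphere, keeps the supremum over a
   nonempty set when n = 0. *)
Definition spectral_norm (R : realType) (m n : nat) (A : 'M[R]_(m, n)) : R :=
  sup [set norm2 (A *m x) | x in [set x : 'cV[R]_n | norm2 x <= 1]].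

Definition meas_mx (R : realType) (m n : nat) (a : 'I_m -> 'cV[R]_n) :
    'M[R]_(m, n) :=
  \matrix_(i < m, j < n) a i j 0.

Definition objective (R : realType) (m n : nat) (a : 'I_m -> 'cV[R]_n)
    (b : 'I_m -> R) (x : 'cV[R]_n) : R :=
  m%:R^-1 * \sum_(i < m) `|dot (a i) x ^+ 2 - b i|.

Definition Lconst (R : realType) (m n : nat) (a : 'I_m -> 'cV[R]_n) : R :=
  2 * spectral_norm (meas_mx a) ^+ 2 / m%:R.

Definition dist_sol (R : realType) (n : nat) (xs x : 'cV[R]_n) : R :=
  Num.min (norm2 (x - xs)) (norm2 (x + xs)).

Definition residual (R : realType) (m n : nat) (a : 'I_m -> 'cV[R]_n)
    (b : 'I_m -> R) (x : 'cV[R]_n) (i : 'I_m) : R :=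
  `|dot (a i) x ^+ 2 - b i|.

(* k-th smallest value with multiplicity; k ranges over 1, ..., m. *)
Definition order_stat (R : realType) (m : nat) (k : nat) (r : 'I_m -> R) : R :=
  nth 0 (sort <=%R [seq r i | i <- enum 'I_m]) k.-1.

Definition outer_h (R : realType) (m : nat) (z : 'cV[R]_m) : R :=
  m%:R^-1 * \sum_(i < m) `|z i 0|.

Definition convex_subdiff (R : realType) (m : nat) (h : 'cV[R]_m -> R)
    (z : 'cV[R]_m) : set 'cV[R]_m :=
  [set g | forall y : 'cV[R]_m, h z + dot g (y - z) <= h y].

Definition inner_c (R : realType) (m n : nat) (a : 'I_m -> 'cV[R]_n)
    (b : 'I_m -> R) (x : 'cV[R]_n) : 'cV[R]_m :=
  \col_(i < m) (dot (a i) x ^+ 2 - b i).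

Definition jacobian_c (R : realType) (m n : nat) (a : 'I_m -> 'cV[R]_n)
    (x : 'cV[R]_n) : 'M[R]_(m, n) :=
  2 *: (diag_mx (meas_mx a *m x)^T *m meas_mx a).

Definition subdiff_F (R : realType) (m n : nat) (a : 'I_m -> 'cV[R]_n)
    (b : 'I_m -> R) (x : 'cV[R]_n) : set 'cV[R]_n :=
  [set (jacobian_c a x)^T *m g
    | g in convex_subdiff (@outer_h R m) (inner_c a b x)].

Definition AdaSubGrad (R : realType) (m n : nat) (a : 'I_m -> 'cV[R]_n)
    (b : 'I_m -> R) (k : nat) (G : R) (x xi : nat -> 'cV[R]_n) : Prop :=
  forall t : nat,
    subdiff_F a b (x t) (xi t) /\
    x t.+1 =
      if xi t == 0 then x t
      else x t - (G * order_stat k (residual a b (x t)) / norm2 (xi t) ^+ 2)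
                 *: xi t.

(* Main.v *)
Require Import Defs.
From mathcomp Require Import all_boot all_order all_algebra.
From mathcomp Require Import classical_sets reals.
From mathcomp Require Import ring lra.
Import Order.TTheory GRing.Theory Num.Theory.
Local Open Scope ring_scope.

(** Write [D] for the distance to the nearest solution [z] among [xs], [-xs],
    and [d] for the objective gap.  The objective is [L]-weakly convex, so
    [<xi, x - z> >= d - L D^2 / 2]; in the basin [L D <= ls (1 - c2/2)] sharpness
    turns this into [<xi, x - z> >= d (1/2 + c2/4)].  The step size is [s d] with
    [c1 <= s <= c2], hence the squared distance drops by at least
    [s (1 + c2/2 - s) d^2 / |xi|^2 >= (1 - c^2) d^2 / (2 |xi|^2)].
    Comparing sharpness and the growth of the objective at [x = 0] gives
    [ls <= L |xs| / 2], so the basin lies in the ball of radius [3/2 |xs|], where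
    [|xi| <= L |x| <= 3/2 L |xs|]. *)

(** * Euclidean inner product and norm *)

Section Euclidean.
Context {R : realType} {n : nat}.
Implicit Types u v w : 'cV[R]_n.

Lemma dotE u v : dot u v = (u^T *m v) 0 0.
Proof. by rewrite mxE; apply: eq_bigr => i _; rewrite mxE. Qed.

Lemma dotC u v : dot u v = dot v u.
Proof. by apply: eq_bigr => i _; rewrite mulrC. Qed.

Lemma dotDr u v w : dot u (v + w) = dot u v + dot u w.
Proof. by rewrite !dotE mulmxDr mxE. Qed.

Lemma dotNr u v : dot u (- v) = - dot u v.
Proof. by rewrite !dotE mulmxN mxE. Qed.

Lemma dotZr (e : R) u v : dot u (e *: v) = e * dot u v.
Proof. by rewrite !dotE -scalemxAr mxE. Qed.

Lemma dotDl u v w : dot (u + v) w = dot u w + dot v w.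
Proof. by rewrite dotC dotDr !(dotC w). Qed.

Lemma dotNl u v : dot (- u) v = - dot u v.
Proof. by rewrite dotC dotNr dotC. Qed.

Lemma dotZl (e : R) u v : dot (e *: u) v = e * dot u v.
Proof. by rewrite dotC dotZr dotC. Qed.

Lemma dot0l v : dot 0 v = 0.
Proof. by rewrite dotE trmx0 mul0mx mxE. Qed.

Lemma dot_ge0 u : 0 <= dot u u.
Proof. by apply: sumr_ge0 => i _; rewrite -expr2 sqr_ge0. Qed.

Lemma dot_eq0 u : (dot u u == 0) = (u == 0).
Proof.
apply/eqP/eqP => [u0|->]; last exact: dot0l.
apply/matrixP => i j; rewrite ord1 mxE; apply/eqP; rewrite -sqrf_eq0 expr2.
have sq_ge0 (l : 'I_n) : true -> 0 <= u l 0 * u l 0 by rewrite -expr2 sqr_ge0.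
by have /allP/(_ i (mem_index_enum i)) := etrans (esym (psumr_eq0 _ sq_ge0)) (introT eqP u0).
Qed.

Lemma norm2_ge0 u : 0 <= norm2 u.
Proof. exact: sqrtr_ge0. Qed.

Lemma sqr_norm2 u : norm2 u ^+ 2 = dot u u.
Proof. by rewrite sqr_sqrtr ?dot_ge0. Qed.

Lemma norm2_eq0 u : (norm2 u == 0) = (u == 0).
Proof. by rewrite -sqrf_eq0 sqr_norm2 dot_eq0. Qed.

Lemma norm2Z (e : R) u : norm2 (e *: u) = `|e| * norm2 u.
Proof. by rewrite /norm2 dotZl dotZr mulrA -expr2 sqrtrM ?sqr_ge0// sqrtr_sqr. Qed.

Lemma norm2N u : norm2 (- u) = norm2 u.
Proof. by rewrite /norm2 dotNl dotNr opprK. Qed.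

Lemma sqr_norm2_subZ (e : R) u v :
  norm2 (u - e *: v) ^+ 2 = norm2 u ^+ 2 - 2 * e * dot v u + e ^+ 2 * norm2 v ^+ 2.
Proof.
rewrite !sqr_norm2 dotDl !dotDr !dotNl !dotNr !dotZl !dotZr (dotC u v).
by ring.
Qed.

(** The vector [dot v v *: u - dot u v *: v] has squared norm [dot v v] times the difference of the
    two sides. *)
Lemma cauchy_schwarz u v : dot u v ^+ 2 <= dot u u * dot v v.
Proof.
have [->|v0] := eqVneq v 0.
  by rewrite (dotC u) !dot0l expr0n mulr0.
have vv0 : 0 < dot v v by rewrite lt_def dot_eq0 v0 dot_ge0.
have := dot_ge0 (dot v v *: u - dot u v *: v).
rewrite dotDl !dotDr !dotNl !dotNr !dotZl !dotZr (dotC v u) => h.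
rewrite -subr_ge0 -(pmulr_rge0 _ vv0); apply: le_trans h _.
by rewrite le_eqVlt; apply/orP; left; apply/eqP; ring.
Qed.

Lemma dot_le_norm2 u v : dot u v <= norm2 u * norm2 v.
Proof.
apply: le_trans (ler_norm _) _.
by rewrite -sqrtr_sqr /norm2 -sqrtrM ?dot_ge0// ler_wsqrtr// cauchy_schwarz.
Qed.

Lemma norm2D u v : norm2 (u + v) <= norm2 u + norm2 v.
Proof.
rewrite -ler_sqr ?nnegrE ?addr_ge0 ?norm2_ge0//.
rewrite sqr_norm2 dotDl !dotDr (dotC v u) sqrrD !sqr_norm2.
by have := dot_le_norm2 u v; lra.
Qed.

End Euclidean.

(** * Operator bounds for a matrix and its transpose *)

Section SpectralNorm.
Context {R : realType} {m n : nat}.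
Implicit Type A : 'M[R]_(m, n).

Lemma dot_mulmx A (u : 'cV[R]_m) (v : 'cV[R]_n) :
  dot (A^T *m u) v = dot u (A *m v).
Proof. by rewrite !dotE trmx_mul trmxK mulmxA. Qed.

(** The bound is the Frobenius norm, by Cauchy-Schwarz on each row. It shows that [spectral_norm] is
    the supremum of a bounded set. *)
Lemma norm2_mulmx_bounded A :
  exists2 M, 0 <= M & forall v : 'cV[R]_n, norm2 (A *m v) <= M * norm2 v.
Proof.
pose M := \sum_(i < m) dot (row i A)^T (row i A)^T.
have M0 : 0 <= M by apply: sumr_ge0 => i _; apply: dot_ge0.
exists (Num.sqrt M) => [|v]; first exact: sqrtr_ge0.
rewrite /norm2 -sqrtrM// ler_wsqrtr// /M mulr_suml.
apply: ler_sum => i _; apply: le_trans (cauchy_schwarz _ _).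
have -> : (A *m v) i 0 = dot (row i A)^T v by rewrite dotE trmxK -row_mul [RHS]mxE.
by rewrite expr2.
Qed.

Lemma norm2_mulmx A (v : 'cV[R]_n) :
  norm2 (A *m v) <= spectral_norm A * norm2 v.
Proof.
have [M M0 AM] := norm2_mulmx_bounded A.
have [->|v0] := eqVneq v 0.
  by rewrite mulmx0 /norm2 !dot0l sqrtr0 mulr0.
have nv0 : 0 < norm2 v by rewrite lt_def norm2_eq0 v0 norm2_ge0.
rewrite -ler_pdivrMr//; apply: ub_le_sup.
  exists M => _ [w /= w1 <-]; apply: le_trans (AM w) _.
  by rewrite ler_piMr.
exists ((norm2 v)^-1 *: v) => /=.
  by rewrite norm2Z ger0_norm ?invr_ge0 ?norm2_ge0// mulVf// gt_eqF.
by rewrite -scalemxAr norm2Z ger0_norm ?invr_ge0 ?norm2_ge0// mulrC.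
Qed.

Lemma spectral_norm_ge0 A : 0 <= spectral_norm A.
Proof.
have [M M0 AM] := norm2_mulmx_bounded A.
apply: le_trans (norm2_ge0 (A *m 0)) _; apply: ub_le_sup.
  exists M => _ [w /= w1 <-]; apply: le_trans (AM w) _.
  by rewrite ler_piMr.
by exists 0 => //=; rewrite /norm2 dot0l sqrtr0.
Qed.

(** The squared left side is [dot u (A *m (A^T *m u))]; Cauchy-Schwarz and [norm2_mulmx] leave one
    factor [norm2 (A^T *m u)] to cancel. *)
Lemma norm2_trmulmx A (u : 'cV[R]_m) :
  norm2 (A^T *m u) <= spectral_norm A * norm2 u.
Proof.
have [->|Au0] := eqVneq (A^T *m u) 0.
  by rewrite /norm2 dot0l sqrtr0 mulr_ge0 ?spectral_norm_ge0 ?sqrtr_ge0.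
have nAu0 : 0 < norm2 (A^T *m u) by rewrite lt_def norm2_eq0 Au0 norm2_ge0.
rewrite -(ler_pM2r nAu0) -expr2 sqr_norm2 dot_mulmx.
apply: le_trans (dot_le_norm2 _ _) _.
by rewrite (mulrC (spectral_norm A)) -mulrA ler_wpM2l ?norm2_ge0 ?norm2_mulmx.
Qed.

End SpectralNorm.

(** * Weak convexity, subgradient size and sharpness of the objective *)

Section PhaseRetrieval.
Context {R : realType} {m n : nat}.
Variables (a : 'I_m -> 'cV[R]_n) (b : 'I_m -> R).
Implicit Types x y xi : 'cV[R]_n.

Lemma meas_mxE x (i : 'I_m) : (meas_mx a *m x) i 0 = dot (a i) x.
Proof. by rewrite mxE; apply: eq_bigr => j _; rewrite mxE. Qed.

Lemma LconstE : Lconst a / 2 = spectral_norm (meas_mx a) ^+ 2 / m%:R.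
Proof. by rewrite /Lconst mulrAC [2 * _]mulrC mulfK// pnatr_eq0. Qed.

Lemma Lconst_ge0 : 0 <= Lconst a.
Proof. by rewrite divr_ge0// mulr_ge0// sqr_ge0. Qed.

(** The left side is [norm2 (meas_mx a *m x) ^+ 2 / m]. It bounds both the remainder in
    [weak_convexity] and the gap at 0 in [sharpness_le]. *)
Lemma mean_sqr_dot_le x :
  m%:R^-1 * \sum_(i < m) dot (a i) x ^+ 2 <= Lconst a / 2 * norm2 x ^+ 2.
Proof.
rewrite LconstE (mulrC _ m%:R^-1) -mulrA ler_wpM2l ?invr_ge0//.
rewrite -exprMn (eq_bigr _ (fun i _ => congr1 (fun t => t ^+ 2) (esym (meas_mxE x i)))).
rewrite (eq_bigr _ (fun i _ => expr2 _)) -/(dot _ _) -sqr_norm2.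
by rewrite ler_sqr ?nnegrE ?mulr_ge0 ?norm2_ge0 ?spectral_norm_ge0 ?norm2_mulmx.
Qed.

Lemma objectiveE x : objective a b x = outer_h (inner_c a b x).
Proof. by congr (_ * _); apply: eq_bigr => i _; rewrite mxE. Qed.

Lemma objectiveN x : objective a b (- x) = objective a b x.
Proof.
by congr (_ * _); apply: eq_bigr => i _; rewrite dotNr sqrrN.
Qed.

(** Moving [z] by one unit along a coordinate, either way, raises [outer_h] by at most [m%:R^-1]. *)
Lemma outer_h_subgradient_le (z g : 'cV[R]_m) (i : 'I_m) :
  convex_subdiff (@outer_h R m) z g -> `|g i 0| <= m%:R^-1.
Proof.
move=> hg.
have dotg (e : R) : dot g (e *: delta_mx i 0) = e * g i 0.
  rewrite dotZr /dot (bigD1 i)//= mxE !eqxx mulr1 big1 ?addr0// => j ji.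
  by rewrite mxE (negbTE ji) mulr0.
have bound (e : R) : `|e| = 1 -> e * g i 0 <= m%:R^-1.
  move=> e1; have := hg (z + e *: delta_mx i 0).
  rewrite [z + _ - z]addrAC subrr add0r dotg -lerBrDl => /le_trans; apply.
  rewrite /outer_h -mulrBr -sumrB ler_piMr ?invr_ge0//.
  rewrite (bigD1 i)//= big1 ?addr0 => [|j ji].
    rewrite !mxE !eqxx mulr1 -[leRHS]e1.
    by have := ler_normD (z i 0) e; rewrite lerBlDl.
  by rewrite !mxE (negbTE ji) mulr0 addr0 subrr.
rewrite ler_norml lerNl; apply/andP; split.
  by rewrite -mulN1r bound// normrN1.
by rewrite -[leLHS]mul1r bound// normr1.
Qed.

Lemma jacobian_mulmx x y (i : 'I_m) :
  (jacobian_c a x *m y) i 0 = 2 * (dot (a i) x * dot (a i) y).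
Proof.
by rewrite /jacobian_c -scalemxAl -mulmxA mxE mul_diag_mx mxE mxE !meas_mxE.
Qed.

(** With [e = dot (a i) (y - x)], coordinate [i] of [inner_c] at [y] is its linearization at [x]
    plus [e ^+ 2]. Since [g i 0 >= - m%:R^-1], the squares cost at most their mean. *)
Lemma weak_convexity x y xi : subdiff_F a b x xi ->
  objective a b x + dot xi (y - x) - Lconst a / 2 * norm2 (y - x) ^+ 2
    <= objective a b y.
Proof.
move=> [g hg <-]; rewrite dot_mulmx !objectiveE.
have := hg (inner_c a b y) => /=; apply: le_trans.
rewrite -addrA lerD2l lerBlDr.
apply: le_trans (lerD (lexx _) (mean_sqr_dot_le (y - x))).
rewrite mulr_sumr -big_split /=; apply: ler_sum => i _.
rewrite jacobian_mulmx !mxE -/(dot _ _).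
have := outer_h_subgradient_le _ _ i hg.
rewrite ler_norml => /andP[gl _].
have -> : dot (a i) y = dot (a i) (y - x) + dot (a i) x by rewrite -dotDr subrK.
have : 0 <= dot (a i) (y - x) ^+ 2 * (g i 0 + m%:R^-1).
  by rewrite mulr_ge0 ?sqr_ge0//; lra.
by lra.
Qed.

(** Here [xi = 2 A^T w] with [w i = dot (a i) x * g i], so [norm2 w <= norm2 (A x) / m]; the
    spectral norm enters once through [A] and once through [A^T]. *)
Lemma subgradient_norm_le x xi : subdiff_F a b x xi ->
  norm2 xi <= Lconst a * norm2 x.
Proof.
move=> [g hg <-].
pose w := diag_mx (meas_mx a *m x)^T *m g.
have -> : (jacobian_c a x)^T *m g = 2 *: ((meas_mx a)^T *m w).
  by rewrite /jacobian_c linearZ /= trmx_mul tr_diag_mx -scalemxAl mulmxA.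
have w_le : norm2 w <= m%:R^-1 * norm2 (meas_mx a *m x).
  rewrite -ler_sqr ?nnegrE ?mulr_ge0 ?invr_ge0 ?norm2_ge0//.
  rewrite exprMn !sqr_norm2 mulr_sumr; apply: ler_sum => i _.
  rewrite /w mul_diag_mx mxE mxE -!expr2 exprMn mulrC ler_wpM2r ?sqr_ge0//.
  rewrite -real_normK ?num_real// ler_sqr ?nnegrE ?invr_ge0//.
  exact: outer_h_subgradient_le hg.
rewrite norm2Z ger0_norm// /Lconst -!mulrA ler_wpM2l//.
apply: le_trans (norm2_trmulmx _ _) _.
rewrite ler_wpM2l ?spectral_norm_ge0//.
apply: le_trans w_le _.
by rewrite mulrCA ler_wpM2l ?invr_ge0 ?norm2_mulmx.
Qed.

(** The objective is even, so the nearer of [xs], [- xs] is a target of equal value. With [z] kept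
    fixed, the distance of the next iterate to [z] bounds its [dist_sol]. *)
Lemma dist_sol_attained (xs x : 'cV[R]_n) :
  exists2 z, norm2 (x - z) = dist_sol xs x &
    [/\ norm2 z = norm2 xs, objective a b z = objective a b xs
      & forall y, dist_sol xs y <= norm2 (y - z)].
Proof.
rewrite /dist_sol; case: (leP (norm2 (x - xs)) (norm2 (x + xs))) => _.
  by exists xs => //; split=> // y; rewrite ge_min lexx.
exists (- xs); first by rewrite opprK.
by split=> [||y]; rewrite ?norm2N ?objectiveN// opprK ge_min lexx orbT.
Qed.

Lemma dist_sol_ge0 (xs x : 'cV[R]_n) : 0 <= dist_sol xs x.
Proof. by rewrite le_min !norm2_ge0. Qed.

(** Sharpness is tested at 0, at distance [norm2 xs]; the gap there is controlled by
    [b i - |t - b i| <= t] for [t = dot (a i) xs ^+ 2]. *)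
Lemma sharpness_le (xs : 'cV[R]_n) (ls : R) :
  (forall i, 0 <= b i) -> xs != 0 ->
  (forall x, ls * dist_sol xs x <= objective a b x - objective a b xs) ->
  ls <= Lconst a / 2 * norm2 xs.
Proof.
move=> b0 xs0 /(_ 0); rewrite /dist_sol sub0r add0r norm2N minxx => sharp0.
have nxs0 : 0 < norm2 xs by rewrite lt_def norm2_eq0 xs0 norm2_ge0.
rewrite -(ler_pM2r nxs0) -[leRHS]mulrA -expr2.
apply: le_trans sharp0 (le_trans _ (mean_sqr_dot_le xs)).
rewrite /objective -mulrBr ler_wpM2l ?invr_ge0// -sumrB; apply: ler_sum => i _.
rewrite (dotC (a i) 0) dot0l expr0n sub0r normrN (ger0_norm (b0 i)).
by have := ler_norm (- (dot (a i) xs ^+ 2 - b i)); rewrite normrN; lra.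
Qed.

End PhaseRetrieval.

(** * Scalar inequalities behind one step *)

Section Contraction.
Context {R : realType}.

(** On [[c1, c2]] the value [|1 - s|] is largest at an endpoint. *)
Lemma sub_sqr_max_le (c1 c2 s : R) : c1 <= s -> s <= c2 ->
  1 - Num.max `|1 - c1| `|1 - c2| ^+ 2 <= s * (2 - s).
Proof.
move=> c1s sc2; have -> : s * (2 - s) = 1 - (1 - s) ^+ 2 by ring.
rewrite lerD2l lerN2 -[leLHS]real_normK ?num_real//.
rewrite ler_sqr ?nnegrE ?le_max ?normr_ge0//.
have [s1|s1] := leP 0 (1 - s).
  by apply/orP; left; rewrite (ger0_norm s1) (le_trans _ (ler_norm _))//; lra.
apply/orP; right; rewrite (ltr0_norm s1).
by rewrite -normrN (le_trans _ (ler_norm _))//; lra.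
Qed.

Lemma sub_sqr_max_ge0 (c1 c2 : R) : 0 < c1 -> c1 <= c2 -> c2 < 2 ->
  0 <= 1 - Num.max `|1 - c1| `|1 - c2| ^+ 2.
Proof.
move=> c10 c12 c22; rewrite subr_ge0 expr_le1 ?le_max ?normr_ge0//.
by rewrite ge_max !ler_norml; apply/andP; split; apply/andP; split; lra.
Qed.

(* [P] is the inner product of the subgradient with [x - z], [al] the step size. *)
Lemma step_gain (c1 c2 L ls D d al P : R) :
  0 < c1 -> 0 <= D -> 0 < d -> ls * D <= d -> L * D <= ls * (1 - c2 / 2) -> c2 < 2 ->
  c1 * d <= al -> al <= c2 * d -> d - L / 2 * D ^+ 2 <= P ->
  (1 - Num.max `|1 - c1| `|1 - c2| ^+ 2) / 2 * d ^+ 2 <= 2 * al * P - al ^+ 2.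
Proof.
move=> c10 D0 d0 lsD LD c22 al1 al2 dP.
pose s := al / d; have al_s : al = s * d by rewrite divfK// gt_eqF.
move: al1 al2; rewrite al_s !ler_pM2r// => c1s sc2.
have s0 : 0 < s by exact: lt_le_trans c1s.
(* The basin condition times [D], then sharpness times [1 - c2 / 2]. *)
have LD2 : L / 2 * D ^+ 2 <= d * (1 - c2 / 2) / 2.
  have h1 : L * D * D <= ls * (1 - c2 / 2) * D by rewrite ler_wpM2r.
  have h2 : ls * D * (1 - c2 / 2) <= d * (1 - c2 / 2) by rewrite ler_wpM2r//; lra.
  by lra.
have P_ge : d * (1 + c2 / 2) <= 2 * P by lra.
(* Split [s (1 + c2/2 - s)] as [s (2 - s)/2 + s (c2 - s)/2] and drop the second, nonnegative
   term. *)
apply: (@le_trans _ _ (s * (2 - s) / 2 * d ^+ 2)).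
  by rewrite ler_wpM2r ?sqr_ge0// ler_wpM2r ?invr_ge0// sub_sqr_max_le.
have h1 : s * d * (d * (1 + c2 / 2)) <= s * d * (2 * P).
  by rewrite ler_wpM2l// mulr_ge0// ltW.
have h2 : 0 <= s * (c2 - s) * d ^+ 2.
  by rewrite mulr_ge0 ?sqr_ge0// mulr_ge0 ?subr_ge0// ltW.
by lra.
Qed.

End Contraction.

(** * Contraction along the iterates *)

Theorem theorem5p1 (R : realType) (m n : nat)
  (a : 'I_m -> 'cV[R]_n) (xs : 'cV[R]_n) (b : 'I_m -> R)
  (I1 I2 : {set 'I_m})
  (I12_cover : I1 :|: I2 = [set: 'I_m]%SET) (I12_disj : [disjoint I1 & I2])
  (b_ge0 : forall i, 0 <= b i)
  (b_I1 : forall i, i \in I1 -> b i = dot (a i) xs ^+ 2)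
  (ls : R) (ls_gt0 : 0 < ls)
  (sharp : forall x : 'cV[R]_n,
     ls * dist_sol xs x <= objective a b x - objective a b xs)
  (p : R) (p_gt0 : 0 < p) (p_lt1 : p < 1)
  (k : nat) (k_gt0 : (0 < k)%N) (mp_k : m%:R * p = k%:R)
  (uL uH : R) (uL_gt0 : 0 < uL) (uH_gt0 : 0 < uH)
  (quantile_bounds : forall x : 'cV[R]_n,
     uL * (objective a b x - objective a b xs)
       <= order_stat k (residual a b x)
       <= uH * (objective a b x - objective a b xs))
  (G : R) (G_gt0 : 0 < G) (G_lt : G < 2 / uH)
  (x xi : nat -> 'cV[R]_n) (x_gen : AdaSubGrad a b k G x xi) :
  let L := Lconst a in
  let c1 := uL * G in
  let c2 := uH * G in
  let c := Num.max `|1 - c1| `|1 - c2| in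
  dist_sol xs (x 0%N) <= ls * (1 - c2 / 2) / L ->
  forall t : nat,
    dist_sol xs (x t) <=
      Num.sqrt (1 - (2 * ls ^+ 2 * (1 - c ^+ 2)) / (9 * L ^+ 2 * norm2 xs ^+ 2))
        ^+ t * dist_sol xs (x 0%N).
Proof.
move=> L c1 c2 c x0_near.
have c10 : 0 < c1 by rewrite mulr_gt0.
have c22 : c2 < 2 by rewrite /c2 mulrC -ltr_pdivlMr.
have L0 : 0 <= L by exact: Lconst_ge0.
pose q := (2 * ls ^+ 2 * (1 - c ^+ 2)) / (9 * L ^+ 2 * norm2 xs ^+ 2).
(* The first inequality keeps the next iterate in the basin, the second is the rate. *)
have step (t : nat) : L * dist_sol xs (x t) <= ls * (1 - c2 / 2) ->
    dist_sol xs (x t.+1) <= dist_sol xs (x t) /\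
    dist_sol xs (x t.+1) <= Num.sqrt (1 - q) * dist_sol xs (x t).
  have [sub_xi ->] := x_gen t; set D := dist_sol xs (x t) => LD.
  have D0 : 0 <= D by exact: dist_sol_ge0.
  set d := objective a b (x t) - objective a b xs.
  have lsD : ls * D <= d by exact: sharp.
  have /andP[r_ge r_le] := quantile_bounds (x t).
  have [z xz [nz Fz dist_le]] := dist_sol_attained a b xs (x t).
  have dP : d - L / 2 * D ^+ 2 <= dot (xi t) (x t - z).
    have := weak_convexity _ _ _ z _ sub_xi.
    rewrite -(opprB (x t) z) dotNr norm2N Fz xz -/D -/L /d; lra.
  set al := G * order_stat k (residual a b (x t)).
  have al_ge : c1 * d <= al by rewrite /c1 (mulrC uL) -mulrA ler_pM2l.
  have al_le : al <= c2 * d by rewrite /c2 (mulrC uH) -mulrA ler_pM2l.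
  (* At a solution the gap vanishes, hence [al = 0] and the iterate stays put in both branches of
     the update. *)
  have [D_eq0|D_neq0] := eqVneq D 0.
    have z_eq : x t = z by apply/eqP; rewrite -subr_eq0 -norm2_eq0 xz -/D D_eq0.
    have d_eq0 : d = 0 by rewrite /d z_eq Fz subrr.
    have al0 : al = 0 by apply/le_anti; rewrite -{1}(mulr0 c2) -{2}(mulr0 c1) -d_eq0 al_le al_ge.
    have -> : dist_sol xs (if xi t == 0 then x t
        else x t - (al / norm2 (xi t) ^+ 2) *: xi t) = D.
      by rewrite al0 mul0r scale0r subr0 if_same.
    by rewrite D_eq0 mulr0.
  have D_gt0 : 0 < D by rewrite lt_def D_neq0.
  have d0 : 0 < d by apply: lt_le_trans lsD; rewrite mulr_gt0.
  have gain := step_gain _ _ _ _ _ _ _ _ c10 D0 d0 lsD LD c22 al_ge al_le dP.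
  have c_le1 : 0 <= 1 - c ^+ 2.
    (* [c1 <= c2] comes from [c1 * d <= al <= c2 * d] with [d > 0]. *)
    by apply: sub_sqr_max_ge0 => //; rewrite -(ler_pM2r d0); apply: le_trans al_le.
  have al_gt0 : 0 < al by apply: lt_le_trans al_ge; rewrite mulr_gt0.
  (* A zero subgradient would make [gain] bound a nonnegative number by [- al ^+ 2 < 0]. *)
  have xi_neq0 : xi t != 0.
    apply: contraTneq gain => xi0; rewrite xi0 dot0l mulr0 sub0r -ltNge.
    apply: (@lt_le_trans _ _ 0); first by rewrite oppr_lt0 exprn_gt0.
    by rewrite mulr_ge0 ?sqr_ge0// divr_ge0.
  rewrite (negbTE xi_neq0); set y := x t - _.
  have N0 : 0 < norm2 (xi t) ^+ 2 by rewrite exprn_gt0// lt_def norm2_eq0 xi_neq0 norm2_ge0.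
  set N := norm2 (xi t) ^+ 2 in N0 y *.
  (* Expanding the square gives [D ^+ 2 - (2 * al * P - al ^+ 2) / N] with
     [P = dot (xi t) (x t - z)]. *)
  have y_dist : norm2 (y - z) ^+ 2 <= D ^+ 2 - (1 - c ^+ 2) / 2 * d ^+ 2 / N.
    have -> : y - z = x t - z - (al / N) *: xi t by rewrite /y addrAC.
    rewrite sqr_norm2_subZ -/N xz -/D.
    have -> : (al / N) ^+ 2 * N = al ^+ 2 / N by field; rewrite gt_eqF.
    have := gain; rewrite -/c -(ler_pM2r (_ : 0 < N^-1)) ?invr_gt0//.
    by lra.
  have drop_ge0 : 0 <= (1 - c ^+ 2) / 2 * d ^+ 2 / N.
    by rewrite divr_ge0 ?(ltW N0)// mulr_ge0 ?sqr_ge0// divr_ge0.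
  have le_D : norm2 (y - z) <= D.
    by rewrite -ler_sqr ?nnegrE ?norm2_ge0//; apply: le_trans y_dist _; rewrite gerBl.
  split; first exact: le_trans (dist_le y) le_D.
  apply: le_trans (dist_le y) _.
  have qD : q * D ^+ 2 <= (1 - c ^+ 2) / 2 * d ^+ 2 / N.
    (* For [L = 0] or [xs = 0] the quotient [q] is a division by zero, hence 0. *)
    have [L_eq0|L_neq0] := eqVneq L 0.
      by rewrite /q L_eq0 expr0n mulr0 mul0r invr0 mulr0 mul0r.
    have [xs_eq0|xs_neq0] := eqVneq xs 0.
      by rewrite /q xs_eq0 /norm2 dot0l sqrtr0 expr0n mulr0 invr0 mulr0 mul0r.
    have L_gt0 : 0 < L by rewrite lt_def L_neq0.
    have X_gt0 : 0 < norm2 xs by rewrite lt_def norm2_eq0 xs_neq0 norm2_ge0.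
    have ls_le : ls <= L / 2 * norm2 xs by exact: sharpness_le b_ge0 xs_neq0 sharp.
    (* [L * D <= ls * (1 - c2 / 2) < ls <= L / 2 * norm2 xs]. *)
    have D_le : D <= norm2 xs / 2.
      have c20 : 0 < c2 by rewrite mulr_gt0.
      have h : 0 < ls * c2 by rewrite mulr_gt0.
      by rewrite -(ler_pM2l L_gt0); lra.
    have xt_le : norm2 (x t) <= 3 / 2 * norm2 xs.
      have := norm2D (x t - z) z; rewrite subrK xz -/D nz; lra.
    have N_le : N <= 9 / 4 * L ^+ 2 * norm2 xs ^+ 2.
      have -> : 9 / 4 * L ^+ 2 * norm2 xs ^+ 2 = (L * (3 / 2 * norm2 xs)) ^+ 2 by field.
      have LX0 : 0 <= L * (3 / 2 * norm2 xs) by rewrite mulr_ge0 // mulr_ge0 ?divr_ge0 ?norm2_ge0.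
      rewrite ler_sqr ?nnegrE ?norm2_ge0//.
      by apply: le_trans (subgradient_norm_le _ _ _ _ sub_xi) _; rewrite ler_wpM2l.
    (* The factor 2/9 of the rate is 1/2 divided by 9/4; sharpness then handles the numerator and
       [N_le] the denominator. *)
    have -> : q * D ^+ 2 =
        (1 - c ^+ 2) / 2 * (ls * D) ^+ 2 / (9 / 4 * L ^+ 2 * norm2 xs ^+ 2).
      by rewrite /q; field; rewrite !gt_eqF.
    apply: ler_pM.
    - by rewrite mulr_ge0 ?sqr_ge0// divr_ge0.
    - by rewrite invr_ge0 (le_trans (ltW N0)).
    - have lsD0 : 0 <= ls * D by rewrite mulr_ge0 ?ltW.
      by rewrite ler_wpM2l ?divr_ge0// ler_sqr ?nnegrE// ltW.
    - by rewrite lef_pV2 ?posrE// (lt_le_trans N0).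
  (* Both sides become square roots; [mulrC] puts [D ^+ 2] first, the factor whose sign [sqrtrM]
     asks for. *)
  rewrite -[leLHS]ger0_norm ?norm2_ge0// -sqrtr_sqr -[X in _ * X]ger0_norm//.
  rewrite -sqrtr_sqr mulrC -sqrtrM ?sqr_ge0// ler_wsqrtr//.
  by apply: le_trans y_dist _; lra.
have LD0 : L * dist_sol xs (x 0%N) <= ls * (1 - c2 / 2).
  (* For [L = 0] the division in [x0_near] yields 0; the claim is then [0 <= ls * (1 - c2 / 2)],
     which [c2 < 2] gives. *)
  have [L_eq0|L_neq0] := eqVneq L 0; first by rewrite L_eq0 mul0r mulr_ge0 ?ltW//; lra.
  by rewrite mulrC -ler_pdivlMr// lt_def L_neq0.
(* The induction also carries that the distance never exceeds its initial value, so that [step]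
   applies again. *)
move=> t; suff [] : dist_sol xs (x t) <= dist_sol xs (x 0%N) /\
    dist_sol xs (x t) <= Num.sqrt (1 - q) ^+ t * dist_sol xs (x 0%N) by [].
elim: t => [|t [le0 IH]]; first by rewrite expr0 mul1r.
have [|le_prev contr] := step t; first by apply: le_trans LD0; rewrite ler_wpM2l.
split; first exact: le_trans le_prev le0.
apply: le_trans contr _.
by rewrite exprS -mulrA ler_wpM2l ?sqrtr_ge0.
Qed.
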